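(* Let $G$ be a group, and let $\tilde\nu\colon\mathbb{Z}[G_{\mathrm{ab}}]\to\mathbb{Z}[G_{\mathrm{abf}}]$ be the linear extension of the projection $\nu\colon G_{\mathrm{ab}}\to G_{\mathrm{abf}}$. Then: (1) The inclusion $G'\hookrightarrow G'_{\mathbb{Q}}$ induces a functorial $\tilde\nu$-morphism $\kappa\colon B(G)\to B_{\mathbb{Q}}(G)$. (2) Suppose $\mathrm{Tors}(G_{\mathrm{ab}})$ is finite. Then the map $\kappa\otimes\mathbb{Q}\colon B(G)\otimes\mathbb{Q}\to B_{\mathbb{Q}}(G)\otimes\mathbb{Q}$ is surjective. (3) Suppose $G_{\mathrm{ab}}$ is torsion-free. Then the map $\kappa\otimes\mathbb{Q}\colon B(G)\otimes\mathbb{Q}\to B_{\mathbb{Q}}(G)\otimes\mathbb{Q}$ is an isomorphism.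
   Context: For $S\subseteq G$, $\sqrt{S}=\{g\in G: g^m\in S\text{ for some }m>0\}$. $G'=[G,G]$, $G''=[G',G']$, $G'_{\mathbb{Q}}=\sqrt{G'}$, $G''_{\mathbb{Q}}=\sqrt{[G'_{\mathbb{Q}},G'_{\mathbb{Q}}]}$, $G_{\mathrm{ab}}=G/G'$, $G_{\mathrm{abf}}=G_{\mathrm{ab}}/\mathrm{Tors}(G_{\mathrm{ab}})=G/G'_{\mathbb{Q}}$. $B(G)=G'/G''$ is a $\mathbb{Z}[G_{\mathrm{ab}}]$-module and $B_{\mathbb{Q}}(G)=G'_{\mathbb{Q}}/G''_{\mathbb{Q}}$ is a $\mathbb{Z}[G_{\mathrm{abf}}]$-module, both via conjugation in $G$. A homomorphism $\alpha\colon G\to H$ induces maps $B(\alpha)\colon B(G)\to B(H)$ and $B_{\mathbb{Q}}(\alpha)\colon B_{\mathbb{Q}}(G)\to B_{\mathbb{Q}}(H)$. For a ring map $\varphi\colon R\to S$, a $\varphi$-morphism from an $R$-module $M$ to an $S$-module $N$ is an additive map $\psi\colon M\to N$ with $\psi(rm)=\varphi(r)\psi(m)$. Functoriality of $\kappa=\kappa^G$ means $\kappa^H\circ B(\alpha)=B_{\mathbb{Q}}(\alpha)\circ\kappa^G$ for every homomorphism $\alpha\colon G\to H$. *)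

(* Defs.v *)
From HB Require Import structures.
From mathcomp Require Import all_boot all_algebra.
From mathcomp Require Import generic_quotient ring_quotient.
From mathcomp Require Import boolp classical_sets cardinality.
From mathcomp.multinomials Require Import freeg.

Set Implicit Arguments.
Unset Strict Implicit.
Unset Printing Implicit Defensive.

Import GRing.Theory.

Local Open Scope classical_set_scope.
Local Open Scope quotient_scope.
Local Open Scope group_scope.

Notation "{ 'hom' G -> H }" := (UMagmaMorphism.type G H)
  (at level 0, G at level 98, H at level 99,
   format "{ 'hom'  G  ->  H }") : type_scope.

Record nsubgroup (G : groupType) := NSubgroup {
  nset :> G -> Prop;
  nsub1 : nset 1;
  nsubF : forall x y, nset x -> nset y -> nset (x / y);
  nsubJ : forall x y, nset x -> nset (x ^ y)
}.

Arguments nsub1 {G} n.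
Arguments nsubF {G} n [x y].
Arguments nsubJ {G} n [x] y.

Section NSubgroupTheory.
Context (G : groupType) (N : nsubgroup G).

Lemma nsubV x : N x -> N x^-1.
Proof. by move=> Nx; rewrite -div1g; apply: nsubF => //; apply: nsub1. Qed.

Lemma nsubM x y : N x -> N y -> N (x * y).
Proof. by move=> Nx /nsubV Ny; rewrite -[y]invgK; apply: nsubF. Qed.

Lemma nsubX x n : N x -> N (x ^+ n).
Proof.
by move=> Nx; elim: n => [|n IHn]; [exact: nsub1 | rewrite expgS; apply: nsubM].
Qed.

Lemma nsubC x y : N (x * y) -> N (y * x).
Proof. by move=> /(nsubJ N x); rewrite conjgE -mulgA mulKg. Qed.

Lemma nsubRl x y : N x -> N [~ x, y].
Proof. by move=> Nx; rewrite commgEl; apply: nsubM; [apply: nsubV|apply: nsubJ]. Qed.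

(* The quotient G / N is made of left cosets: x ~ y iff x^-1 * y \in N. *)
Definition quot_rel (x y : G) : bool := `[< N (x^-1 * y) >].

Lemma quot_rel_is_equiv : equiv_class_of quot_rel.
Proof.
split=> [x|x y|y x z].
- by apply/asboolP; rewrite mulVg; apply: nsub1.
- by apply/asboolP/asboolP => /nsubV; rewrite invgM invgK.
- move=> /asboolP xy /asboolP yz; apply/asboolP.
  by rewrite -[z](mulVKg y) mulgA; apply: nsubM.
Qed.

Canonical quot_equiv := EquivRelPack quot_rel_is_equiv.
Canonical quot_encModRel := defaultEncModRel quot_rel.

Definition quot := {eq_quot quot_rel}.

HB.instance Definition _ : EqQuotient G quot_rel quot := EqQuotient.on quot.
HB.instance Definition _ := Choice.on quot.

Definition qpi (x : G) : quot := \pi x.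

Lemma qpiP x y : qpi x = qpi y <-> N (x^-1 * y).
Proof.
split=> [/eqmodP/asboolP //|xy].
by apply/eqmodP/asboolP.
Qed.

Lemma qpi_repr (a : quot) : qpi (repr a) = a.
Proof. exact: reprK. Qed.

Lemma qpi_surj (a : quot) : exists x, a = qpi x.
Proof. by exists (repr a); rewrite qpi_repr. Qed.

Lemma repr_qpi x : N ((repr (qpi x))^-1 * x).
Proof. by apply/qpiP; rewrite qpi_repr. Qed.

Definition quot_one : quot := qpi 1.
Definition quot_inv (a : quot) : quot := qpi (repr a)^-1.
Definition quot_mul (a b : quot) : quot := qpi (repr a * repr b).

Lemma quot_mulE x y : quot_mul (qpi x) (qpi y) = qpi (x * y).
Proof.
apply/qpiP; rewrite invgM.
set u := repr (qpi x); set v := repr (qpi y).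
have -> : v^-1 / u * (x * y) = (u^-1 * x) ^ v * (v^-1 * y).
  by rewrite conjgE !mulgA mulgK.
by apply: nsubM; [apply: nsubJ|]; apply: repr_qpi.
Qed.

Lemma quot_invE x : quot_inv (qpi x) = qpi x^-1.
Proof.
apply/qpiP; rewrite invgK; apply: nsubC.
by have /nsubV := repr_qpi x; rewrite invgM invgK.
Qed.

Lemma quot_mulgA : associative quot_mul.
Proof.
move=> a b c; have [x ->] := qpi_surj a; have [y ->] := qpi_surj b.
by have [z ->] := qpi_surj c; rewrite !quot_mulE mulgA.
Qed.

Lemma quot_mul1g : left_id quot_one quot_mul.
Proof. by move=> a; have [x ->] := qpi_surj a; rewrite quot_mulE mul1g. Qed.

Lemma quot_mulg1 : right_id quot_one quot_mul.
Proof. by move=> a; have [x ->] := qpi_surj a; rewrite quot_mulE mulg1. Qed.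

Lemma quot_mulVg : left_inverse quot_one quot_inv quot_mul.
Proof.
by move=> a; have [x ->] := qpi_surj a; rewrite quot_invE quot_mulE mulVg.
Qed.

Lemma quot_mulgV : right_inverse quot_one quot_inv quot_mul.
Proof.
by move=> a; have [x ->] := qpi_surj a; rewrite quot_invE quot_mulE mulgV.
Qed.

HB.instance Definition _ :=
  isGroup.Build quot quot_mulgA quot_mul1g quot_mulg1 quot_mulVg quot_mulgV.

Lemma qpiM : {morph qpi : x y / x * y}.
Proof. by move=> x y; rewrite -quot_mulE. Qed.

Lemma qpi1 : qpi 1 = 1. Proof. by []. Qed.

HB.instance Definition _ := isUMagmaMorphism.Build G quot qpi (qpi1, qpiM).

Lemma qpi_eq1 x : qpi x = 1 <-> N x.
Proof.
split=> [/esym/qpiP|Nx]; first by rewrite invg1 mul1g.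
by apply/esym/qpiP; rewrite invg1 mul1g.
Qed.

Definition nsubtype := {x : G | x \in (nset N : set G)}.

HB.instance Definition _ := [isSub of nsubtype for @sval _ _].
HB.instance Definition _ := [Choice of nsubtype by <:].

Lemma nsub_group_closed : group_closed [pred x : G | x \in (nset N : set G)].
Proof.
split=> [|x y]; rewrite !inE; first exact/nsub1.
exact: nsubF.
Qed.

HB.instance Definition _ := SubChoice_isSubGroup.Build G
  [pred x : G | x \in (nset N : set G)] nsubtype nsub_group_closed.

Definition nelt (x : G) (Nx : N x) : nsubtype := exist _ x (mem_set Nx).

Lemma nsubtypeP (x : nsubtype) : N (val x).
Proof. exact/set_mem/(valP x). Qed.

Lemma neltK (x : nsubtype) : nelt (nsubtypeP x) = x.
Proof. exact/val_inj. Qed.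

End NSubgroupTheory.

Definition radical (G : groupType) (S : set G) : set G :=
  [set g | exists2 m : nat, (0 < m)%N & S (g ^+ m)].

(* [H, K], the subgroup generated by the commutators [~ x, y] with x in H and
   y in K. *)
Inductive commutator (G : groupType) (H K : set G) : G -> Prop :=
| commutator1 : commutator H K 1
| commutator_gen x y : H x -> K y -> commutator H K [~ x, y]
| commutatorF x y :
    commutator H K x -> commutator H K y -> commutator H K (x / y).

Lemma commutatorJ (G : groupType) (H K : set G) :
    (forall x y, H x -> H (x ^ y)) -> (forall x y, K x -> K (x ^ y)) ->
  forall x y, commutator H K x -> commutator H K (x ^ y).
Proof.
move=> HJ KJ x z; elim=> {x} [|x y Hx Ky|x y _ IHx _ IHy].
- by rewrite conj1g; apply: commutator1.
- by rewrite conjRg; apply: commutator_gen; auto.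
- by rewrite conjMg conjVg; apply: commutatorF.
Qed.

Definition commutator_nsub (G : groupType) (H K : nsubgroup G) : nsubgroup G :=
  NSubgroup (@commutator1 G H K) (@commutatorF G H K)
    (commutatorJ (nsubJ H) (nsubJ K)).

Definition full_nsub (G : groupType) : nsubgroup G :=
  @NSubgroup G [set: G] I (fun _ _ _ _ => I) (fun _ _ _ => I).

(* \sqrt(N) is a normal subgroup as soon as its elements commute modulo N. *)
Section RadicalNSub.
Context (G : groupType) (N : nsubgroup G).
Hypothesis NR : forall x y, radical N x -> radical N y -> N [~ x, y].

Lemma radical1 : radical N 1.
Proof. by exists 1%N; rewrite ?expg1 //; apply: nsub1. Qed.

Lemma radicalJ x y : radical N x -> radical N (x ^ y).
Proof. by case=> m m0 Nx; exists m => //; rewrite -conjXg; apply: nsubJ. Qed.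

Lemma radicalV x : radical N x -> radical N x^-1.
Proof. by case=> m m0 Nx; exists m => //; rewrite expVgn; apply: nsubV. Qed.

Lemma radicalF x y : radical N x -> radical N y -> radical N (x / y).
Proof.
move=> Rx Ry; have := NR Rx (radicalV Ry); move: Rx Ry.
case=> m m0 Nx [n n0 Ny] Nxy.
have cxy : commute (qpi N x) (qpi N y^-1).
  by apply/commgP/eqP; rewrite -gmulfR; apply/qpi_eq1.
exists (m * n)%N; first by rewrite muln_gt0 m0.
apply/qpi_eq1; rewrite gmulfXn gmulfM expgMn //.
have /qpi_eq1 : N (x ^+ (m * n)) by rewrite expgnA; apply: nsubX.
have /qpi_eq1 : N (y^-1 ^+ (m * n)).
  by rewrite expVgn; apply: nsubV; rewrite mulnC expgnA; apply: nsubX.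
by rewrite !gmulfXn => -> ->; rewrite mulg1.
Qed.

Definition radical_nsub : nsubgroup G := NSubgroup radical1 radicalF radicalJ.

Lemma sub_radical x : N x -> radical N x.
Proof. by move=> Nx; exists 1%N. Qed.

End RadicalNSub.

Section Series.
Context (G : groupType).

(* G' = der, G'' = dder, G'_Q = derQ and G''_Q = dderQ, all as subgroups of G;
   both radicals are taken in G. *)
Definition der : nsubgroup G := commutator_nsub (full_nsub G) (full_nsub G).

Definition dder : nsubgroup G := commutator_nsub der der.

Lemma der_comm (x y : G) : der [~ x, y].
Proof. exact: commutator_gen. Qed.

Definition derQ : nsubgroup G :=
  @radical_nsub G der (fun x y _ _ => der_comm x y).

Lemma derQ_radical (x : G) : radical derQ x -> derQ x.
Proof.
case=> m m0 [n n0 Nx]; exists (m * n)%N; first by rewrite muln_gt0 m0.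
by rewrite expgnA.
Qed.

Lemma commutator_derQ_sub (x : G) : commutator_nsub derQ derQ x -> derQ x.
Proof.
elim=> {x} [|x y Hx _|x y _ Hx _ Hy]; [exact: nsub1|exact: nsubRl|exact: nsubF].
Qed.

Lemma radical_commutator_derQ (x y : G) :
    radical (commutator_nsub derQ derQ) x ->
    radical (commutator_nsub derQ derQ) y ->
  commutator_nsub derQ derQ [~ x, y].
Proof.
move=> Rx Ry; apply: commutator_gen; apply: derQ_radical.
- by case: Rx => m m0 /commutator_derQ_sub; exists m.
- by case: Ry => m m0 /commutator_derQ_sub; exists m.
Qed.

Definition dderQ : nsubgroup G :=
  @radical_nsub G (commutator_nsub derQ derQ) radical_commutator_derQ.

Lemma der_sub_derQ (x : G) : der x -> derQ x.
Proof. exact: sub_radical. Qed.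

Definition ab : groupType := quot der.
Definition abf : groupType := quot derQ.

(* The projection of G/G' onto G/G'_Q; see nu_qpi. *)
Definition nu (a : ab) : abf := qpi derQ (repr a).

Lemma nu_qpi (x : G) : nu (qpi der x) = qpi derQ x.
Proof. exact/qpiP/der_sub_derQ/repr_qpi. Qed.

Lemma nu_is_monoid_morphism : monoid.monoid_morphism nu.
Proof.
split=> [|a b]; first by rewrite -(qpi1 der) nu_qpi qpi1.
have [x ->] := qpi_surj a; have [y ->] := qpi_surj b.
by rewrite -qpiM !nu_qpi qpiM.
Qed.

HB.instance Definition _ := isUMagmaMorphism.Build ab abf nu nu_is_monoid_morphism.

End Series.

Definition Tors (A : groupType) : set A := radical [set 1].
Arguments Tors : clear implicits.

(* G/G'_Q is the quotient of G_ab by its torsion subgroup. *)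
Lemma nu_surj (G : groupType) (b : abf G) : exists a, nu a = b.
Proof. by have [x ->] := qpi_surj b; exists (qpi (der G) x); rewrite nu_qpi. Qed.

Lemma nu_ker (G : groupType) (a : ab G) : nu a = 1 <-> Tors (ab G) a.
Proof.
have [x ->] := qpi_surj a; rewrite nu_qpi.
split=> [/qpi_eq1[m m0 Nx]|[m m0 xm]].
  by exists m => //; rewrite /= -gmulfXn; apply/qpi_eq1.
by apply/qpi_eq1; exists m => //; apply/qpi_eq1; rewrite gmulfXn.
Qed.

Local Open Scope ring_scope.

Section FreeAbelian.
Context (K : choiceType).

Lemma freeg_induct (P : {freeg K} -> Prop) :
    P 0 -> (forall x, P << x >>) -> (forall u v, P u -> P v -> P (u - v)) ->
  forall u, P u.
Proof.
move=> P0 P1 PB u.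
have PD v w : P v -> P w -> P (v + w).
  by move=> Pv Pw; rewrite -[w]opprK; apply: (PB) => //; rewrite -sub0r; apply: PB.
have PM v n : P v -> P (v *+ n).
  by move=> Pv; elim: n => [|n IHn]; rewrite ?mulr0n // mulrS; apply: PD.
have PZ v (c : int) : P v -> P (v *~ c).
  move=> Pv; case: c => n; first exact: PM.
  by rewrite NegzE mulrNz -sub0r; apply: PB => //; apply: PM.
rewrite -(freeg_sumE u); elim/big_ind: _ => // x _.
by rewrite -[coeff x u]intz -freegU_mulz; apply: PZ.
Qed.

Context (M : zmodType) (f : K -> M).

(* The additive extension of f : K -> M to the free abelian group on K; the
   Z-module structure on M comes from the alias zmodule. *)
Definition freeg_ext (u : {freeg K}) : M := fglift (f : K -> zmodule M) u.

Lemma freeg_extU x : freeg_ext << x >> = f x.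
Proof. by rewrite /freeg_ext liftU scale1r. Qed.

Lemma freeg_ext_is_additive : zmod_morphism freeg_ext.
Proof. exact: (@lift_is_additive int K (zmodule M) f). Qed.

HB.instance Definition _ :=
  GRing.isZmodMorphism.Build {freeg K} M freeg_ext freeg_ext_is_additive.

End FreeAbelian.

Lemma freeg_extB (K : choiceType) (M : zmodType) (f g : K -> M) u :
  freeg_ext (fun x => f x - g x) u = freeg_ext f u - freeg_ext g u.
Proof.
elim/freeg_induct: u => [|x|u v IHu IHv]; first by rewrite ?raddf0 addr0.
  by rewrite !freeg_extU.
by rewrite !freeg_ext_is_additive IHu IHv !opprD !opprK addrACA.
Qed.

Lemma freeg_ext0 (K : choiceType) (M : zmodType) (u : {freeg K}) :
  freeg_ext (fun _ => 0 : M) u = 0.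
Proof.
elim/freeg_induct: u => [|x|u v IHu IHv]; rewrite ?raddf0 ?freeg_extU //.
by rewrite freeg_ext_is_additive IHu IHv subr0.
Qed.

Lemma eq_freeg_ext (K : choiceType) (M : zmodType) (f g : K -> M) :
  f =1 g -> freeg_ext f =1 freeg_ext g.
Proof. by move=> /funext ->. Qed.

Section GroupRing.
Context (G : groupType).

(* Z[G]. The {malg _} of multinomials cannot be used here: it only allows
   monoids without nontrivial units. *)
Definition groupring : Type := {freeg G}.

HB.instance Definition _ := GRing.Zmodule.on groupring.

Definition gr_of (g : G) : groupring := << g >>.

Definition gr_one : groupring := gr_of 1%g.
Definition gr_mul (u v : groupring) : groupring :=
  freeg_ext (fun g => freeg_ext (fun h => gr_of (g * h)%g) v) u.

Lemma gr_mulU g h : gr_mul (gr_of g) (gr_of h) = gr_of (g * h)%g.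
Proof. by rewrite /gr_mul !freeg_extU. Qed.

Lemma gr_mulBl u v w : gr_mul (u - v) w = gr_mul u w - gr_mul v w.
Proof. exact: freeg_ext_is_additive. Qed.

Lemma gr_mulBr u v w : gr_mul u (v - w) = gr_mul u v - gr_mul u w.
Proof. by rewrite -freeg_extB; apply: eq_freeg_ext => g; rewrite freeg_ext_is_additive. Qed.

Lemma gr_mul0l w : gr_mul 0 w = 0.
Proof. exact: raddf0. Qed.

Lemma gr_mul0r u : gr_mul u 0 = 0.
Proof. by have := gr_mulBr u 0 0; rewrite !subrr. Qed.

Lemma gr_mulDl : left_distributive gr_mul +%R.
Proof.
move=> u v w; have e := gr_mulBl (u + v) v w.
by rewrite addrK in e; rewrite e subrK.
Qed.

Lemma gr_mulDr : right_distributive gr_mul +%R.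
Proof.
move=> u v w; have e := gr_mulBr u (v + w) w.
by rewrite addrK in e; rewrite e subrK.
Qed.

Lemma gr_mulA : associative gr_mul.
Proof.
move=> u v w; elim/freeg_induct: u => [|g|u1 u2 IH1 IH2]; first by rewrite !gr_mul0l.
  elim/freeg_induct: v => [|h|v1 v2 IH1 IH2]; first by rewrite !(gr_mul0l, gr_mul0r).
    elim/freeg_induct: w => [|k|w1 w2 IH1 IH2]; first by rewrite !gr_mul0r.
      by rewrite !gr_mulU mulgA.
    by rewrite !gr_mulBr IH1 IH2.
  by rewrite !(gr_mulBr, gr_mulBl) IH1 IH2.
by rewrite !gr_mulBl IH1 IH2.
Qed.

Lemma gr_mul1r : left_id gr_one gr_mul.
Proof.
move=> u; elim/freeg_induct: u => [|g|u v IHu IHv]; first exact: gr_mul0r.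
  by rewrite gr_mulU mul1g.
by rewrite gr_mulBr IHu IHv.
Qed.

Lemma gr_mulr1 : right_id gr_one gr_mul.
Proof.
move=> u; elim/freeg_induct: u => [|g|u v IHu IHv]; first exact: gr_mul0l.
  by rewrite gr_mulU mulg1.
by rewrite gr_mulBl IHu IHv.
Qed.

Lemma gr_one_neq0 : gr_one != 0.
Proof. by rewrite freegU_eq0. Qed.

HB.instance Definition _ := GRing.Zmodule_isNzRing.Build groupring
  gr_mulA gr_mul1r gr_mulr1 gr_mulDl gr_mulDr gr_one_neq0.

Lemma gr_ofM g h : gr_of (g * h)%g = gr_of g * gr_of h.
Proof. by rewrite -gr_mulU. Qed.

Lemma gr_of1 : gr_of 1%g = 1.
Proof. by []. Qed.

End GroupRing.

Section GroupRingMap.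
Context (G H : groupType) (f : {hom G -> H}).

Definition groupring_map (u : groupring G) : groupring H :=
  freeg_ext (fun g => gr_of (f g)) u.

Lemma groupring_mapU g : groupring_map (gr_of g) = gr_of (f g).
Proof. exact: freeg_extU. Qed.

Lemma groupring_map_is_additive : zmod_morphism groupring_map.
Proof. exact: freeg_ext_is_additive. Qed.

HB.instance Definition _ := GRing.isZmodMorphism.Build
  (groupring G) (groupring H) groupring_map groupring_map_is_additive.

Lemma groupring_map_is_multiplicative : GRing.monoid_morphism groupring_map.
Proof.
split; first by rewrite -gr_of1 groupring_mapU gmulf1.
move=> u v; elim/freeg_induct: u => [|g|u1 u2 IH1 IH2].
- by rewrite mul0r !raddf0 mul0r.
- elim/freeg_induct: v => [|h|v1 v2 IH1 IH2].
  + by rewrite mulr0 !raddf0 mulr0.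
  + by rewrite -gr_ofM !groupring_mapU gmulfM gr_ofM.
  + by rewrite mulrBr !groupring_map_is_additive IH1 IH2 mulrBr.
- by rewrite mulrBl !groupring_map_is_additive IH1 IH2 mulrBl.
Qed.

HB.instance Definition _ := GRing.isMonoidMorphism.Build
  (groupring G) (groupring H) groupring_map groupring_map_is_multiplicative.

End GroupRingMap.

(* A pair (T, L) of normal subgroups of G with [T, T] contained in L. The group
   T / (T :&: L), denoted secmod below, is abelian, and T acts trivially on it
   by conjugation, so that it is a Z[G/T]-module. *)
Record abelian_section (G : groupType) := AbelianSection {
  stop : nsubgroup G;
  sbot : nsubgroup G;
  stop_comm : forall x y, stop x -> stop y -> sbot [~ x, y]%g
}.

Section SectionModule.
Context (G : groupType) (S : abelian_section G).

Let T := stop S.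
Let L := sbot S.

Let in_bot (x : nsubtype T) : Prop := L (val x).

Fact in_bot1 : in_bot 1%g.
Proof. by rewrite /in_bot val1; apply: nsub1. Qed.

Fact in_botF x y : in_bot x -> in_bot y -> in_bot (x / y)%g.
Proof. by rewrite /in_bot gmulfF; apply: nsubF. Qed.

Fact in_botJ x y : in_bot x -> in_bot (x ^ y)%g.
Proof. by rewrite /in_bot gmulfJ; apply: nsubJ. Qed.

Definition sbot_in_stop : nsubgroup (nsubtype (stop S)) :=
  NSubgroup in_bot1 in_botF in_botJ.

Definition secmod : Type := quot sbot_in_stop.

HB.instance Definition _ := Choice.on secmod.

Definition cls (x : nsubtype (stop S)) : secmod := qpi sbot_in_stop x.

Lemma clsP x y : cls x = cls y <-> L ((val x)^-1 * val y)%g.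
Proof. by rewrite -gmulfV -valM; apply: qpiP. Qed.

Lemma cls_repr (m : secmod) : cls (repr m) = m.
Proof. exact: qpi_repr. Qed.

Lemma cls_surj (m : secmod) : exists x, m = cls x.
Proof. by exists (repr m); rewrite cls_repr. Qed.

Definition sec_zero : secmod := (1 : quot sbot_in_stop)%g.
Definition sec_opp (m : secmod) : secmod := (m : quot sbot_in_stop)^-1%g.
Definition sec_add (m n : secmod) : secmod := ((m : quot sbot_in_stop) * n)%g.

Lemma sec_addA : associative sec_add.
Proof. exact: mulgA. Qed.

Lemma sec_addC : commutative sec_add.
Proof.
move=> m n; have [x ->] := cls_surj m; have [y ->] := cls_surj n.
rewrite /sec_add /cls -!qpiM; apply/clsP.
rewrite valM valM invgM -mulgA; have := stop_comm (nsubtypeP y) (nsubtypeP x).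
by rewrite /commg /conjg.
Qed.

Lemma sec_add0 : left_id sec_zero sec_add.
Proof. exact: mul1g. Qed.

Lemma sec_addN : left_inverse sec_zero sec_opp sec_add.
Proof. exact: mulVg. Qed.

HB.instance Definition _ :=
  GRing.isZmodule.Build secmod sec_addA sec_addC sec_add0 sec_addN.

Lemma clsD x y : cls (x * y)%g = cls x + cls y.
Proof. exact: qpiM. Qed.

Lemma clsN x : cls x^-1%g = - cls x.
Proof. exact: gmulfV. Qed.

Lemma cls1 : cls 1%g = 0.
Proof. by []. Qed.

Lemma cls_eq0 x : cls x = 0 <-> L (val x).
Proof. exact: qpi_eq1. Qed.

(* mathcomp has x ^ y = y^-1 * x * y, so this is the left action
   g * x * g^-1; see cls_act for the resulting module structure. *)
Definition sec_conj (g : G) (x : nsubtype (stop S)) : nsubtype (stop S) :=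
  nelt (nsubJ (stop S) g^-1%g (nsubtypeP x)).

Definition sec_act (a : quot (stop S)) (m : secmod) : secmod :=
  cls (sec_conj (repr a) (repr m)).

Lemma sec_actE g x : sec_act (qpi _ g) (cls x) = cls (sec_conj g x).
Proof.
apply/clsP; rewrite /= -conjVg.
set g' := repr (qpi _ g); set x' := repr (cls x).
have Th : T (g'^-1 * g)%g := repr_qpi (stop S) g.
have Lx : L ((val x')^-1 * val x)%g by apply/clsP/cls_repr.
have -> : g^-1%g = ((g'^-1 * g)^-1 * g'^-1)%g by rewrite invgM invgK mulgK.
rewrite conjgM -conjMg; apply: nsubJ.
set k := (g'^-1 * g)^-1%g.
have -> : (val x ^ k)%g = (val x * [~ val x, k])%g by rewrite commgEl mulVKg.
rewrite mulgA; apply: nsubM => //.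
by apply: stop_comm; [exact: nsubtypeP | exact: nsubV].
Qed.

Lemma sec_act_is_additive a : zmod_morphism (sec_act a).
Proof.
have [g ->] := qpi_surj a => m n.
have [x ->] := cls_surj m; have [y ->] := cls_surj n.
rewrite -clsN -clsD !sec_actE -clsN -clsD; congr cls; apply: val_inj.
by rewrite /= conjMg conjVg.
Qed.

Lemma sec_act1 m : sec_act 1%g m = m.
Proof.
have [x ->] := cls_surj m; rewrite -(qpi1 (stop S)) sec_actE.
by congr cls; apply: val_inj; rewrite /= invg1 conjg1.
Qed.

Lemma sec_actM a b m : sec_act (a * b)%g m = sec_act a (sec_act b m).
Proof.
have [x ->] := cls_surj m.
have [g ->] := qpi_surj a; have [h ->] := qpi_surj b.
rewrite -qpiM !sec_actE; congr cls; apply: val_inj.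
by rewrite /= invgM conjgM.
Qed.

Definition sec_scale (r : groupring (quot (stop S))) (m : secmod) : secmod :=
  freeg_ext (fun a => sec_act a m) r.

Lemma sec_scaleU a m : sec_scale (gr_of a) m = sec_act a m.
Proof. exact: freeg_extU. Qed.

Lemma sec_scaleBl u v m : sec_scale (u - v) m = sec_scale u m - sec_scale v m.
Proof. exact: freeg_ext_is_additive. Qed.

Lemma sec_scaleBr u m n : sec_scale u (m - n) = sec_scale u m - sec_scale u n.
Proof.
by rewrite -freeg_extB; apply: eq_freeg_ext => a; rewrite sec_act_is_additive.
Qed.

Lemma sec_scale0 m : sec_scale 0 m = 0.
Proof. by have := sec_scaleBl 0 0 m; rewrite !subrr. Qed.

Lemma sec_scaleA u v m : sec_scale u (sec_scale v m) = sec_scale (u * v) m.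
Proof.
elim/freeg_induct: u => [|a|u1 u2 IH1 IH2]; first by rewrite mul0r !sec_scale0.
  elim/freeg_induct: v => [|b|v1 v2 IH1 IH2].
  - rewrite mulr0 !sec_scale0.
    by have := sec_scaleBr << a >> 0 0; rewrite !subrr.
  - by rewrite -gr_ofM !sec_scaleU sec_actM.
  - by rewrite mulrBr !(sec_scaleBl, sec_scaleBr) IH1 IH2.
by rewrite mulrBl !sec_scaleBl IH1 IH2.
Qed.

Lemma sec_scale1 : left_id 1 sec_scale.
Proof. by move=> m; rewrite -gr_of1 sec_scaleU sec_act1. Qed.

Lemma sec_scaleDr : right_distributive sec_scale +%R.
Proof.
move=> u m n; have e := sec_scaleBr u (m + n) n.
by rewrite addrK in e; rewrite e subrK.
Qed.

Lemma sec_scaleDl m : {morph sec_scale^~ m : u v / u + v}.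
Proof.
move=> u v; have e := sec_scaleBl (u + v) v m.
by rewrite addrK in e; rewrite e subrK.
Qed.

HB.instance Definition _ := GRing.Zmodule_isLmodule.Build
  (groupring (quot (stop S))) secmod
  sec_scaleA sec_scale1 sec_scaleDr sec_scaleDl.

Lemma cls_act g x : gr_of (qpi (stop S) g) *: cls x = cls (sec_conj g x).
Proof. by rewrite -sec_actE -sec_scaleU. Qed.

End SectionModule.

(* The map induced by a group morphism f on abelian sections. It is defined by
   a choice of representatives; sec_map_cls shows that it is independent of it. *)
Section SectionMap.
Context (G H : groupType) (S : abelian_section G) (S' : abelian_section H).
Context (f : {hom G -> H}).
Hypothesis f_top : forall x, stop S x -> stop S' (f x).
Hypothesis f_bot : forall x, sbot S x -> sbot S' (f x).

Definition sec_restr (x : nsubtype (stop S)) : nsubtype (stop S') :=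
  nelt (f_top (nsubtypeP x)).

Definition sec_map (m : secmod S) : secmod S' := cls (sec_restr (repr m)).

Lemma sec_map_cls x : sec_map (cls x) = cls (sec_restr x).
Proof.
apply/clsP; rewrite /= -gmulfV -gmulfM; apply: f_bot.
by apply/clsP/cls_repr.
Qed.

Lemma sec_map_is_additive : zmod_morphism sec_map.
Proof.
move=> m n; have [x ->] := cls_surj m; have [y ->] := cls_surj n.
rewrite -clsN -clsD !sec_map_cls -clsN -clsD; congr cls; apply: val_inj.
by rewrite /= gmulfM gmulfV.
Qed.

End SectionMap.

Section AlexanderModules.
Context (G : groupType).

Fact der_dder (x y : G) : der G x -> der G y -> dder G [~ x, y]%g.
Proof. exact: commutator_gen. Qed.

Fact derQ_dderQ (x y : G) : derQ G x -> derQ G y -> dderQ G [~ x, y]%g.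
Proof. by move=> Hx Hy; apply: sub_radical; apply: commutator_gen. Qed.

Definition B_section : abelian_section G := AbelianSection der_dder.
Definition BQ_section : abelian_section G := AbelianSection derQ_dderQ.

(* B(G) = G'/G'' and B_Q(G) = G'_Q/G''_Q. *)
Definition B : lmodType (groupring (ab G)) :=
  GRing.Lmodule.clone _ (secmod B_section) _.
Definition BQ : lmodType (groupring (abf G)) :=
  GRing.Lmodule.clone _ (secmod BQ_section) _.

Definition Bcls (x : nsubtype (der G)) : B := cls (S := B_section) x.
Definition BQcls (x : nsubtype (derQ G)) : BQ := cls (S := BQ_section) x.

Definition der_incl (x : nsubtype (der G)) : nsubtype (derQ G) :=
  nelt (der_sub_derQ (nsubtypeP x)).

Definition nu_tilde : {rmorphism groupring (ab G) -> groupring (abf G)} :=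
  groupring_map (@nu G).

End AlexanderModules.

Section Functoriality.
Context (G H : groupType) (alpha : {hom G -> H}).

Lemma commutator_hom (K L : set G) (K' L' : set H) :
    (forall x, K x -> K' (alpha x)) -> (forall x, L x -> L' (alpha x)) ->
  forall x, commutator K L x -> commutator K' L' (alpha x).
Proof.
move=> KK' LL' x; elim=> {x} [|x y Kx Ly|x y _ IHx _ IHy].
- by rewrite gmulf1; apply: commutator1.
- by rewrite gmulfR; apply: commutator_gen; auto.
- by rewrite gmulfF; apply: commutatorF.
Qed.

Lemma radical_hom (K : set G) (K' : set H) :
    (forall x, K x -> K' (alpha x)) ->
  forall x, radical K x -> radical K' (alpha x).
Proof. by move=> KK' x [m m0 Kx]; exists m; rewrite // -gmulfXn; apply: KK'. Qed.

Lemma der_hom x : der G x -> der H (alpha x).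
Proof. exact: commutator_hom. Qed.

Lemma dder_hom x : dder G x -> dder H (alpha x).
Proof. by apply: commutator_hom; apply: der_hom. Qed.

Lemma derQ_hom x : derQ G x -> derQ H (alpha x).
Proof. exact/radical_hom/der_hom. Qed.

Lemma dderQ_hom x : dderQ G x -> dderQ H (alpha x).
Proof. by apply: radical_hom; apply: commutator_hom; apply: derQ_hom. Qed.

Definition B_map : B G -> B H :=
  sec_map (S := B_section G) (S' := B_section H) der_hom.

Definition BQ_map : BQ G -> BQ H :=
  sec_map (S := BQ_section G) (S' := BQ_section H) derQ_hom.

Lemma B_mapE (x : nsubtype (der G)) :
  B_map (Bcls x) = Bcls (nelt (der_hom (nsubtypeP x))).
Proof. exact/sec_map_cls/dder_hom. Qed.

Lemma BQ_mapE (x : nsubtype (derQ G)) :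
  BQ_map (BQcls x) = BQcls (nelt (derQ_hom (nsubtypeP x))).
Proof. exact/sec_map_cls/dderQ_hom. Qed.

Fact B_map_is_additive : zmod_morphism B_map.
Proof. exact/sec_map_is_additive/dder_hom. Qed.

Fact BQ_map_is_additive : zmod_morphism BQ_map.
Proof. exact/sec_map_is_additive/dderQ_hom. Qed.

HB.instance Definition _ :=
  GRing.isZmodMorphism.Build (B G) (B H) B_map B_map_is_additive.
HB.instance Definition _ :=
  GRing.isZmodMorphism.Build (BQ G) (BQ H) BQ_map BQ_map_is_additive.

End Functoriality.

Definition phi_morphism (R S : pzRingType) (phi : {rmorphism R -> S})
    (M : lmodType R) (N : lmodType S) (psi : M -> N) : Prop :=
  {morph psi : m n / m + n} /\ forall r m, psi (r *: m) = phi r *: psi m.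

Section Tensor.
Context (A C : zmodType).

(* The tensor product over Z of A and C, as the quotient of the free abelian
   group on A * C by the subgroup generated by the bilinearity relations. *)
Inductive tensor_rel : {freeg (A * C)} -> Prop :=
| tensor_rel0 : tensor_rel 0
| tensor_relDl a a' c :
    tensor_rel (<< (a + a', c) >> - << (a, c) >> - << (a', c) >>)
| tensor_relDr a c c' :
    tensor_rel (<< (a, c + c') >> - << (a, c) >> - << (a, c') >>)
| tensor_relB u v : tensor_rel u -> tensor_rel v -> tensor_rel (u - v).

Definition tensor_pred : {pred {freeg (A * C)}} := fun u => `[< tensor_rel u >].

Fact tensor_pred_closed : zmod_closed tensor_pred.
Proof.
split=> [|u v /asboolP ru /asboolP rv]; apply/asboolP; first exact: tensor_rel0.
exact: tensor_relB.
Qed.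

HB.instance Definition _ :=
  GRing.isZmodClosed.Build {freeg (A * C)} tensor_pred tensor_pred_closed.

Definition tensor : zmodType := @Quotient.quot {freeg (A * C)} tensor_pred.

Definition tensor_pi (u : {freeg (A * C)}) : tensor :=
  \pi_(@Quotient.quot {freeg (A * C)} tensor_pred) u.

Definition tens (a : A) (c : C) : tensor := tensor_pi << (a, c) >>.

Lemma tensor_piP u v : tensor_pi u = tensor_pi v <-> tensor_rel (u - v).
Proof.
have e : (tensor_pred (u - v)) = (tensor_pi u == tensor_pi v).
  exact: (@Quotient.idealrBE {freeg (A * C)} tensor_pred u v).
split=> [uv|ruv]; first by apply/asboolP; rewrite -[`[< _ >]]/(tensor_pred _) e uv.
by apply/eqP; rewrite -e; apply/asboolP.
Qed.

Lemma tensor_pi_is_additive : zmod_morphism tensor_pi.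
Proof. by move=> u v; rewrite /tensor_pi !piE. Qed.

HB.instance Definition _ := GRing.isZmodMorphism.Build
  {freeg (A * C)} tensor tensor_pi tensor_pi_is_additive.

Lemma tensor_pi_repr (t : tensor) : tensor_pi (repr t) = t.
Proof. exact: reprK. Qed.

Lemma tensDl a a' c : tens (a + a') c = tens a c + tens a' c.
Proof.
apply/eqP; rewrite -subr_eq0 opprD addrA -!tensor_pi_is_additive.
by rewrite -(raddf0 tensor_pi); apply/eqP/tensor_piP; rewrite subr0; exact: tensor_relDl.
Qed.

Lemma tensDr a c c' : tens a (c + c') = tens a c + tens a c'.
Proof.
apply/eqP; rewrite -subr_eq0 opprD addrA -!tensor_pi_is_additive.
by rewrite -(raddf0 tensor_pi); apply/eqP/tensor_piP; rewrite subr0; exact: tensor_relDr.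
Qed.

End Tensor.

Section TensorMap.
Context (A A' C : zmodType) (f : {additive A -> A'}).

(* The map f (x) id_C; see tensor_map_tens. *)
Definition tensor_map (t : tensor A C) : tensor A' C :=
  freeg_ext (fun p => tens (f p.1) p.2) (repr t).

Lemma tensor_map_pi (u : {freeg (A * C)}) :
  tensor_map (tensor_pi u) = freeg_ext (fun p => tens (f p.1) p.2) u.
Proof.
apply/subr0_eq; rewrite -freeg_ext_is_additive.
have /tensor_piP : tensor_pi (repr (tensor_pi u)) = tensor_pi u.
  exact: tensor_pi_repr.
elim=> [|a a' c|a c c'|v w _ IHv _ IHw].
- exact: raddf0.
- by rewrite !freeg_ext_is_additive !freeg_extU raddfD tensDl addrAC addrK subrr.
- by rewrite !freeg_ext_is_additive !freeg_extU tensDr addrAC addrK subrr.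
- by rewrite freeg_ext_is_additive IHv IHw subr0.
Qed.

Lemma tensor_map_tens a c : tensor_map (tens a c) = tens (f a) c.
Proof. by rewrite tensor_map_pi freeg_extU. Qed.

Lemma tensor_map_is_additive : zmod_morphism tensor_map.
Proof.
move=> t t'; rewrite -[t]tensor_pi_repr -[t']tensor_pi_repr.
by rewrite -tensor_pi_is_additive !tensor_map_pi freeg_ext_is_additive.
Qed.

HB.instance Definition _ := GRing.isZmodMorphism.Build
  (tensor A C) (tensor A' C) tensor_map tensor_map_is_additive.

End TensorMap.

(* Main.v *)
Require Import Defs.
From HB Require Import structures.
From mathcomp Require Import all_boot all_algebra.
From mathcomp Require Import boolp classical_sets cardinality.
From mathcomp.multinomials Require Import freeg.

(** The point is that [kappa : G'/G'' -> G'_Q/G''_Q] always has torsion cokernel,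
    and has torsion kernel as soon as [G_ab] is torsion-free; tensoring with the
    rationals does not see torsion.

    - Cokernel: an element [g] of [G'_Q] has a power [g ^+ m] in [G'], so [m] times
      the class of [g] is the image of the class of [g ^+ m]
      ([kappa_torsion_coker]).
    - Kernel: a class killed by [kappa] is represented by [x] in [G'] with
      [x ^+ m] in [[G'_Q, G'_Q]].  If [G_ab] is torsion-free, then [G'_Q = G'],
      so that [x ^+ m] lies in [G''] and [m] kills the class of [x]
      ([kappa_torsion_ker]).

    For any additive [f : A -> A'] with torsion cokernel, the tensor
    [b (x) q] equals [f a (x) (q / m)] whenever [f a = b *+ m], whence
    surjectivity ([tensor_map_rat_surj]).  When the kernel is torsion too, the
    tensor [a (x) (q / m)] depends only on [b] and [q]
    ([tens_fraction_uniq]), and [b (x) q |-> a (x) (q / m)] is the inverse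
    ([tensor_map_rat_bij]). *)

Set Implicit Arguments.
Unset Strict Implicit.
Unset Printing Implicit Defensive.

Import GRing.Theory Num.Theory.
Local Open Scope classical_set_scope.
Local Open Scope ring_scope.

Section TensorUniversal.
Context (A C : zmodType).

Lemma tensor_ind (P : tensor A C -> Prop) :
    P 0 -> (forall a c, P (tens a c)) -> (forall s t, P s -> P t -> P (s - t)) ->
  forall t, P t.
Proof.
move=> P0 Ptens PB t; rewrite -[t]tensor_pi_repr.
elim/freeg_induct: (repr t) => [|[a c]|u v IHu IHv]; first by rewrite raddf0.
  exact: Ptens.
by rewrite tensor_pi_is_additive; apply: PB.
Qed.

Lemma tensMnl (a : A) (c : C) n : tens (a *+ n) c = tens a c *+ n.
Proof.
elim: n => [|n IHn]; last by rewrite !mulrS tensDl IHn.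
by apply: (addrI (tens 0 c)); rewrite -tensDl !addr0.
Qed.

Lemma tensMnr (a : A) (c : C) n : tens a (c *+ n) = tens a c *+ n.
Proof.
elim: n => [|n IHn]; last by rewrite !mulrS tensDr IHn.
by apply: (addrI (tens a 0)); rewrite -tensDr !addr0.
Qed.

Lemma tensBl (a a' : A) (c : C) : tens (a - a') c = tens a c - tens a' c.
Proof. by apply/eqP; rewrite eq_sym subr_eq -tensDl subrK. Qed.

Context (M : zmodType) (h : A -> C -> M).
Hypothesis hDl : forall a a' c, h (a + a') c = h a c + h a' c.
Hypothesis hDr : forall a c c', h a (c + c') = h a c + h a c'.

(** Universal property of the tensor product.  The lift is computed on a
    representative in the free group; the biadditivity of [h] makes it vanish on
    the defining relations, hence independent of that choice. *)
Lemma tensor_lift :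
  exists g : {additive tensor A C -> M}, forall a c, g (tens a c) = h a c.
Proof.
pose h1 (p : A * C) := h p.1 p.2.
pose g (t : tensor A C) := freeg_ext h1 (repr t).
have gE u : g (tensor_pi u) = freeg_ext h1 u.
  apply/subr0_eq; rewrite -freeg_ext_is_additive.
  have /tensor_piP : tensor_pi (repr (tensor_pi u)) = tensor_pi u.
    exact: tensor_pi_repr.
  elim=> [|a a' c|a c c'|v w _ IHv _ IHw].
  - exact: raddf0.
  - by rewrite !freeg_ext_is_additive !freeg_extU /h1 /= hDl addrAC addrK subrr.
  - by rewrite !freeg_ext_is_additive !freeg_extU /h1 /= hDr addrAC addrK subrr.
  - by rewrite freeg_ext_is_additive IHv IHw subr0.
have gB : zmod_morphism g.
  move=> s t; rewrite -[s]tensor_pi_repr -[t]tensor_pi_repr.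
  by rewrite -tensor_pi_is_additive !gE freeg_ext_is_additive.
pose mx := GRing.isZmodMorphism.Build (tensor A C) M g gB.
pose gA : {additive tensor A C -> M} := HB.pack g mx.
by exists gA => a c; rewrite /= gE freeg_extU.
Qed.

End TensorUniversal.

Section RationalTensor.
Context (A A' : zmodType) (f : {additive A -> A'}).

Definition torsion_coker := forall b, exists a m, (0 < m)%N /\ f a = b *+ m.
Definition torsion_ker := forall a, f a = 0 -> exists2 m, (0 < m)%N & a *+ m = 0.

Lemma divr_natK (q : rat) m : (0 < m)%N -> (q / m%:R) *+ m = q.
Proof.
by move=> m0; rewrite -mulr_natr divfK // pnatr_eq0 -lt0n.
Qed.

Lemma tens_torsion (a : A) m (q : rat) : (0 < m)%N -> a *+ m = 0 -> tens a q = 0.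
Proof.
move=> m0 am; rewrite -(divr_natK q m0) tensMnr -tensMnl am.
by rewrite -(mulr0n 0) tensMnl mulr0n.
Qed.

Lemma tensor_map_fraction a b m (q : rat) : (0 < m)%N -> f a = b *+ m ->
  tensor_map f (tens a (q / m%:R)) = tens b q.
Proof.
by move=> m0 fa; rewrite tensor_map_tens fa tensMnl -tensMnr divr_natK.
Qed.

(** Denominators in the rational factor absorb the multiple needed to bring
    [b] into the image of [f]. *)
Lemma tensor_map_rat_surj : torsion_coker ->
  forall y : tensor A' rat, exists x, tensor_map (C := rat) f x = y.
Proof.
move=> cokf; elim/tensor_ind => [|b q|s t [x <-] [y <-]].
- by exists 0; rewrite raddf0.
- have [a [m [m0 fa]]] := cokf b.
  by exists (tens a (q / m%:R)); apply: tensor_map_fraction.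
- by exists (x - y); rewrite raddfB.
Qed.

(** Cross-multiplying, [a *+ m' - a' *+ m] lies in the kernel of [f], hence is
    torsion and dies in the tensor product. *)
Lemma tens_fraction_uniq a a' b m m' (q : rat) : torsion_ker ->
    (0 < m)%N -> (0 < m')%N -> f a = b *+ m -> f a' = b *+ m' ->
  tens a (q / m%:R) = tens a' (q / m'%:R).
Proof.
move=> kerf m0 m'0 fa fa'.
have : f (a *+ m' - a' *+ m) = 0.
  by rewrite raddfB !raddfMn /= fa fa' mulNrn mulrnAC subrr.
move=> /kerf[k k0 dk]; apply/eqP; rewrite -subr_eq0; apply/eqP.
rewrite -(divr_natK (q / m%:R) m'0) -(divr_natK (q / m'%:R) m0).
rewrite !tensMnr -!tensMnl (mulrAC q) -tensBl.
exact: tens_torsion dk.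
Qed.

(** The rule [b (x) q |-> a (x) (q / m)], where [f a = b *+ m], is biadditive
    because [a] and [m] may be chosen freely: its lift to the tensor product
    inverts [f (x) id]. *)
Lemma tensor_map_rat_bij : torsion_coker -> torsion_ker ->
  bijective (tensor_map (C := rat) f).
Proof.
move=> cokf kerf.
pose h b (q : rat) := let a := sval (cid (cokf b)) in
  let m := sval (cid (svalP (cid (cokf b)))) in tens a (q / m%:R).
have hE a b m q : (0 < m)%N -> f a = b *+ m -> h b q = tens a (q / m%:R).
  move=> m0 fa; rewrite /h; case: cid => a' /= [m' [m'0 fa']].
  case: cid => n /= [n0 fan].
  exact: tens_fraction_uniq fan fa.
have hDr b q q' : h b (q + q') = h b q + h b q'.
  have [a [m [m0 fa]]] := cokf b.
  by rewrite !(hE _ _ _ _ m0 fa) mulrDl tensDr.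
have hDl b b' q : h (b + b') q = h b q + h b' q.
  have [a [m [m0 fa]]] := cokf b; have [a' [m' [m'0 fa']]] := cokf b'.
  (* Over the common denominator [m * m']. *)
  have mm0 : (0 < m * m')%N by rewrite muln_gt0 m0.
  have fb : f (a *+ m') = b *+ (m * m') by rewrite raddfMn /= fa mulrnA.
  have fb' : f (a' *+ m) = b' *+ (m * m').
    by rewrite raddfMn /= fa' mulnC mulrnA.
  have fbb : f (a *+ m' + a' *+ m) = (b + b') *+ (m * m').
    by rewrite raddfD /= fb fb' mulrnDl.
  by rewrite (hE _ _ _ _ mm0 fb) (hE _ _ _ _ mm0 fb') (hE _ _ _ _ mm0 fbb) tensDl.
have [g gE] := tensor_lift hDl hDr; exists g.
- elim/tensor_ind => [|a q|s t IHs IHt]; first by rewrite !raddf0.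
    (* [a] is itself a numerator of [f a], over the denominator 1. *)
    rewrite tensor_map_tens gE (hE a _ 1%N) ?divr1 //.
  by rewrite !raddfB /= IHs IHt.
- elim/tensor_ind => [|b q|s t IHs IHt]; first by rewrite !raddf0.
    have [a [m [m0 fa]]] := cokf b.
    by rewrite gE (hE _ _ _ _ m0 fa); apply: tensor_map_fraction.
  by rewrite !raddfB /= IHs IHt.
Qed.

End RationalTensor.

Section Kappa.
Context (G : groupType).

Lemma dder_sub_dderQ x : dder G x -> dderQ G x.
Proof.
move=> Nx; apply: sub_radical.
by apply: (commutator_hom (alpha := idfun)) Nx; apply: der_sub_derQ.
Qed.

(** Taking the morphism of sections over the identity of [G] makes the inclusion
    of [G'] into [G'_Q] a special case of the functoriality in [G]. *)
Definition kappa_fun : B G -> BQ G :=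
  sec_map (S := B_section G) (S' := BQ_section G) (f := idfun) (@der_sub_derQ G).

Lemma kappa_funE x : kappa_fun (Bcls x) = BQcls (der_incl x).
Proof.
apply: (sec_map_cls (S := B_section G) (S' := BQ_section G) (f := idfun)).
exact: dder_sub_dderQ.
Qed.

Fact kappa_fun_is_additive : zmod_morphism kappa_fun.
Proof.
apply: (sec_map_is_additive (S := B_section G) (S' := BQ_section G) (f := idfun)).
exact: dder_sub_dderQ.
Qed.

HB.instance Definition _ :=
  GRing.isZmodMorphism.Build (B G) (BQ G) kappa_fun kappa_fun_is_additive.

Definition kappa : {additive B G -> BQ G} := kappa_fun.

Lemma kappaE x : kappa (Bcls x) = BQcls (der_incl x).
Proof. exact: kappa_funE. Qed.

(** Both actions are by conjugation in [G], so the scalars [gr_of a] are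
    immediate; the others follow by additivity. *)
Lemma kappa_phi_morphism : phi_morphism (nu_tilde G) kappa.
Proof.
split=> [m n|r m]; first exact: raddfD.
elim/freeg_induct: r => [|a|u v IHu IHv]; first by rewrite scale0r !raddf0 scale0r.
  have [g ->] := qpi_surj a; have [x ->] := cls_surj m.
  rewrite -[<< _ >>]/(gr_of _) /nu_tilde /= groupring_mapU /= nu_qpi.
  rewrite -[cls x]/(Bcls x) kappaE.
  have -> : gr_of (qpi (der G) g) *: Bcls x = Bcls (sec_conj g x).
    exact: (@cls_act G (B_section G)).
  rewrite kappaE; symmetry.
  rewrite [LHS](@cls_act G (BQ_section G)); congr (BQcls _); exact: val_inj.
by rewrite scalerBl !raddfB /= IHu IHv scalerBl.
Qed.

Lemma BclsX (x : nsubtype (der G)) n : Bcls (x ^+ n)%g = Bcls x *+ n.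
Proof.
elim: n => [//|n IHn].
by rewrite expgS mulrS -IHn; exact: (@clsD G (B_section G)).
Qed.

Lemma BQclsX (x : nsubtype (derQ G)) n : BQcls (x ^+ n)%g = BQcls x *+ n.
Proof.
elim: n => [//|n IHn].
by rewrite expgS mulrS -IHn; exact: (@clsD G (BQ_section G)).
Qed.

(** The multiple is the exponent that witnesses membership in the radical. *)
Lemma kappa_torsion_coker : torsion_coker kappa.
Proof.
move=> b; have [x ->] := cls_surj b; have [m m0 xm] := nsubtypeP x.
exists (Bcls (nelt xm)), m; split=> //.
rewrite kappaE -BQclsX; congr (BQcls _); apply: val_inj.
by rewrite gmulfXn.
Qed.

(** [G'_Q / G'] is the torsion subgroup of [G_ab]. *)
Lemma Tors_ab_trivial_derQ : Tors (ab G) = [set 1%g] ->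
  forall x, derQ G x -> der G x.
Proof.
move=> tf x Nx; apply/qpi_eq1.
suff : Tors (ab G) (qpi (der G) x) by rewrite tf.
by apply/nu_ker; rewrite nu_qpi; apply/qpi_eq1.
Qed.

(** Once [G'_Q = G'], the group [G''_Q] is the radical of [G''], and the
    kernel of [kappa] is its intersection with [G'], modulo [G'']. *)
Lemma kappa_torsion_ker : Tors (ab G) = [set 1%g] -> torsion_ker kappa.
Proof.
move=> /Tors_ab_trivial_derQ dQ a; have [x ->] := cls_surj a.
rewrite -[cls x]/(Bcls x) kappaE.
move=> /(@cls_eq0 G (BQ_section G))[m m0 Nx]; exists m => //.
rewrite -BclsX; apply/(@cls_eq0 G (B_section G)); rewrite gmulfXn.
by apply: (commutator_hom (alpha := idfun)) Nx.
Qed.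

End Kappa.

Lemma kappa_natural (G H : groupType) (alpha : {hom G -> H}) (m : B G) :
  kappa H (B_map alpha m) = BQ_map alpha (kappa G m).
Proof.
have [x ->] := cls_surj m; rewrite -[cls x]/(Bcls x).
rewrite B_mapE !kappaE BQ_mapE; congr (BQcls _); exact: val_inj.
Qed.

Theorem proposition3p5 :
  exists kappa : forall G : groupType, {additive B G -> BQ G},
    (forall (G : groupType) (x : nsubtype (der G)),
        kappa G (Bcls x) = BQcls (der_incl x)) /\
    (forall G : groupType, phi_morphism (nu_tilde G) (kappa G)) /\
    (forall (G H : groupType) (alpha : {hom G -> H}) (m : B G),
        kappa H (B_map alpha m) = BQ_map alpha (kappa G m)) /\
    (forall G : groupType, finite_set (Tors (ab G)) ->
        forall y : tensor (BQ G) rat,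
          exists x : tensor (B G) rat, tensor_map (C := rat) (kappa G) x = y) /\
    (forall G : groupType, Tors (ab G) = [set 1%g] ->
        bijective (tensor_map (C := rat) (kappa G))).
Proof.
exists kappa; split; first exact: kappaE.
split; first exact: kappa_phi_morphism.
split; first exact: kappa_natural.
split=> G tG; first exact/tensor_map_rat_surj/kappa_torsion_coker.
exact: tensor_map_rat_bij (@kappa_torsion_coker G) (kappa_torsion_ker tG).
Qed.
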